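(* Let $\Gamma$ be a digraph with vertex set $V=\{1,\dots,n\}$, $n>1$. For $\tau>0$ and $i,j\in V$ let $s_{ij}=\sum_{P\in\mathcal{P}^{ij}}\tau^{l(P)}w(P)$, where $\mathcal{P}^{ij}$ is the set of all directed paths from $i$ to $j$ in $\Gamma$, $l(P)$ is the length of $P$ and $w(P)$ its weight. Then there exists $\tau_0>0$ such that for every $\tau\in(0,\tau_0)$ the matrix $S=(s_{ij})$ determines a transitional measure for $\Gamma$.
   Context: A digraph $\Gamma$ here is a weighted directed multigraph without loops, with vertex set $\{1,\dots,n\}$; each arc has a positive weight. A directed path from $v_0$ to $v_k$ is an alternating sequence $v_0,a_1,v_1,\dots,a_k,v_k$ of vertices and arcs in which all vertices are distinct and each $a_i$ is an arc from $v_{i-1}$ to $v_i$; its length is $k$ and its weight is the product of the weights of its arcs. For each vertex $v_0$ the sequence $v_0$ is the unique path from $v_0$ to $v_0$, with length $0$ and weight $1$ (so $s_{ii}=1$). $S$ satisfies the transition inequality if $s_{ij}s_{jk}\le s_{ik}s_{jj}$ for all $i,j,k$; it satisfies the graph bottleneck identity w.r.t. $\Gamma$ if for all $i,j,k$: $s_{ij}s_{jk}=s_{ik}s_{jj}$ holds if and only if every directed path in $\Gamma$ from $i$ to $k$ contains $j$. $S$ determines a transitional measure for $\Gamma$ if it satisfies both. *)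

(* Defs.v *)
From HB Require Import structures.
From mathcomp Require Import all_boot all_order all_algebra reals.

Set Implicit Arguments.
Unset Strict Implicit.
Unset Printing Implicit Defensive.

Import Order.TTheory GRing.Theory Num.Theory.
Local Open Scope ring_scope.

(* Parallel arcs are distinct elements of [arcs G] with the same endpoints.
   The vertex set {1, ..., n} is represented by 'I_n = {0, ..., n-1}. *)
Record digraph (R : numDomainType) (n : nat) := Digraph {
  arcs : finType;
  src : arcs -> 'I_n;
  tgt : arcs -> 'I_n;
  weight : arcs -> R;
  loopless : forall a, src a != tgt a;
  weight_gt0 : forall a, 0 < weight a
}.

Section Paths.
Variables (R : numDomainType) (n : nat) (G : digraph R n).

(* The alternating sequence v_0, a_1, v_1, ..., a_k, v_k is encoded by its
   first vertex v_0 and the sequence [:: (a_1, v_1); ...; (a_k, v_k)]. *)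
Definition steps := seq (arcs G * 'I_n).

Definition vertices (v0 : 'I_n) (p : steps) : seq 'I_n := v0 :: unzip2 p.

Fixpoint is_walk (v0 : 'I_n) (p : steps) : bool :=
  if p is (a, v) :: p' then [&& src a == v0, tgt a == v & is_walk v p']
  else true.

Definition is_dipath (i j : 'I_n) (p : steps) : bool :=
  [&& is_walk i p, last i (unzip2 p) == j & uniq (vertices i p)].

Definition path_weight (p : steps) : R := \prod_(e <- p) weight e.1.

Lemma dipath_size i j p : is_dipath i j p -> (size p < n)%N.
Proof.
case/and3P=> _ _ /card_uniqP Up.
have := max_card [in vertices i p].
by rewrite Up card_ord /= size_map.
Qed.

(* By [dipath_size], bounding the number of steps by n excludes no path;
   it makes the index type of the sum finite. *)
Definition path_matrix (tau : R) : 'M[R]_n :=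
  \matrix_(i, j) \sum_(p : n.-bseq (arcs G * 'I_n) | is_dipath i j p)
    tau ^+ size p * path_weight p.

Definition transition_inequality (S : 'M[R]_n) : Prop :=
  forall i j k : 'I_n, S i j * S j k <= S i k * S j j.

Definition graph_bottleneck_identity (S : 'M[R]_n) : Prop :=
  forall i j k : 'I_n,
    S i j * S j k = S i k * S j j <->
    (forall p : steps, is_dipath i k p -> j \in vertices i p).

Definition transitional_measure (S : 'M[R]_n) : Prop :=
  transition_inequality S /\ graph_bottleneck_identity S.

End Paths.

(* Main.v *)
(* Since s_jj = 1, compare s_ij s_jk with s_ik.  Expand s_ij s_jk as a sum over
   pairs (P, Q) of paths i -> j -> k.  The pairs whose concatenation is a path
   biject with the paths i -> k through j, so s_ik - s_ij s_jk is the sum over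
   the paths avoiding j minus the sum over the colliding pairs.  If P and Q meet
   in some v <> j, following P up to v and then Q from v on avoids j and is
   strictly shorter than PQ.  So without paths avoiding j there is no collision
   and equality holds; otherwise, if d is the least length of a path avoiding j,
   the first sum is at least c tau^d and the second is O(tau^(d+1)). *)
Require Import Defs.
From mathcomp Require Import all_boot all_order all_algebra reals.

Set Implicit Arguments.
Unset Strict Implicit.
Unset Printing Implicit Defensive.

Import Order.TTheory GRing.Theory Num.Theory.
Local Open Scope ring_scope.

Lemma last_take (T : Type) (x : T) (s : seq T) (m : nat) :
  (m <= size s)%N -> last x (take m s) = nth x (x :: s) m.
Proof.
by elim: s x m => [|y s IHs] x [|m] //= Hm; rewrite IHs //; apply: set_nth_default.
Qed.

(** * Walks, paths, and cutting or joining them at a vertex *)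

Section Dipaths.
Context {R : numDomainType} {n : nat} {G : digraph R n}.
Implicit Types (i j k v : 'I_n) (p q r : steps G).

Lemma unzip2_cat p q : unzip2 (p ++ q) = unzip2 p ++ unzip2 q.
Proof. exact: map_cat. Qed.

Lemma is_walk_cat i p q :
  is_walk i (p ++ q) = is_walk i p && is_walk (last i (unzip2 p)) q.
Proof. by elim: p i => [|[a v] p IHp] i //=; rewrite IHp !andbA. Qed.

Lemma path_weight_gt0 p : 0 < path_weight p.
Proof. by apply: prodr_gt0 => e _; apply: weight_gt0. Qed.

Lemma path_weight_cat p q : path_weight (p ++ q) = path_weight p * path_weight q.
Proof. exact: big_cat. Qed.

Lemma split_at_vertex i v p : v \in vertices i p ->
  exists p1 p2, p = p1 ++ p2 /\ last i (unzip2 p1) = v.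
Proof.
move=> vp; exists (take (index v (vertices i p)) p).
exists (drop (index v (vertices i p)) p); rewrite cat_take_drop; split=> //.
have := vp; rewrite -index_mem /= ltnS => le_m.
by rewrite /unzip2 map_take last_take // nth_index.
Qed.

(** Loop erasure, by induction on the walk. The vertex and length clauses are what lets the erased
    walk in [colliding_shortcut] still avoid [j] and stay short. *)
Lemma walk_has_dipath i k r : is_walk i r -> last i (unzip2 r) = k ->
  exists r', [/\ is_dipath i k r', {subset vertices i r' <= vertices i r}
               & (size r' <= size r)%N].
Proof.
elim: r i => [|[a v] r IHr] i /=.
  by move=> _ <-; exists [::]; split=> //; rewrite /is_dipath /= eqxx.
case/and3P=> sa ta wr lr; have [r' [dr' sub le_r']] := IHr v wr lr.
(* If the path extracted from the tail already visits [i], keep only its part from [i] on; otherwise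
   prepend the first arc. *)
have [ir'|ir'] := boolP (i \in vertices v r'); last first.
  exists ((a, v) :: r'); split=> //.
    case/and3P: dr' => w l u; apply/and3P; split=> //=; first exact/and3P.
    exact/andP.
  move=> x; rewrite inE => /orP[/eqP->|/sub xr]; first exact: mem_head.
  by rewrite /vertices inE xr orbT.
have [p1 [p2 [Er' l1]]] := split_at_vertex ir'.
subst r'; case/and3P: dr'; rewrite is_walk_cat l1 /vertices unzip2_cat last_cat l1 -cat_cons.
case/andP=> _ w2 l2; rewrite lastI l1 cat_rcons cat_uniq => /and3P[_ _ u2].
exists p2; split.
- exact/and3P.
- move=> x; rewrite inE => /orP[/eqP->|x2]; first exact: mem_head.
  have: x \in vertices v (p1 ++ p2).
    by rewrite /vertices unzip2_cat inE mem_cat x2 !orbT.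
  by move/sub=> xr; rewrite /vertices inE xr orbT.
- by rewrite (leq_trans _ (leqW le_r')) // size_cat leq_addl.
Qed.

Definition concatenable i j k p q : bool :=
  [&& is_dipath i j p, is_dipath j k q & uniq (vertices i (p ++ q))].

Definition colliding i j k p q : bool :=
  [&& is_dipath i j p, is_dipath j k q & ~~ uniq (vertices i (p ++ q))].

Definition avoiding i j k r : bool := is_dipath i k r && (j \notin vertices i r).

Lemma colliding_shortcut i j k p q : colliding i j k p q ->
  exists2 r, avoiding i j k r & (size r < size p + size q)%N.
Proof.
case/and3P=> /and3P[wp /eqP lp up] /and3P[wq /eqP lq uq].
have /andP[jq uq'] : (j \notin unzip2 q) && uniq (unzip2 q) := uq.
rewrite /vertices unzip2_cat -cat_cons cat_uniq up uq' andbT negbK.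
case/hasP=> v vq vp.
have vj : v != j by apply: contraNneq jq => <-.
have [p1 [p2 [Ep l1]]] := split_at_vertex vp.
have vq' : v \in vertices j q by rewrite inE vq orbT.
have [q1 [q2 [Eq l2]]] := split_at_vertex vq'.
subst p q; move: wp wq; rewrite !is_walk_cat l1 l2.
case/andP=> wp1 _ /andP[_ wq2].
have w : is_walk i (p1 ++ q2) by rewrite is_walk_cat wp1 l1.
have l : last i (unzip2 (p1 ++ q2)) = k.
  by move: lq; rewrite !unzip2_cat !last_cat l1 l2.
(* The first path ends at [j] and [v != j], so [j] comes strictly after [v]; by simplicity the
   prefix [p1] then misses [j]. *)
have jp2 : j \in unzip2 p2.
  move: lp; rewrite unzip2_cat last_cat l1.
  case: (unzip2 p2) => [/= Ev|y s /= <-]; first by rewrite Ev eqxx in vj.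
  exact: mem_last.
have jp1 : j \notin vertices i p1.
  move: up; rewrite /vertices unzip2_cat -cat_cons cat_uniq.
  by case/and3P=> _ /hasPn/(_ _ jp2).
have [r [dr sub le_r]] := walk_has_dipath w l.
exists r.
  rewrite /avoiding dr; apply: contra jp1 => /sub.
  rewrite /vertices unzip2_cat -cat_cons mem_cat => /orP[//|jq2].
  by rewrite unzip2_cat mem_cat jq2 orbT in jq.
apply: (leq_ltn_trans le_r); rewrite !size_cat.
(* The discarded piece [p2] contains [j], hence is nonempty: this gives strictness. *)
have p2_gt0 : (0 < size p2)%N by case: (p2) jp2.
by rewrite -addnA ltn_add2l; apply: leq_add p2_gt0 (leq_addl _ _).
Qed.

(** Cutting at the first visit to [j] undoes concatenation. Paths missing [j] must be rejected too,
    since the reindexing in [sum_concatenable] ranges over all [r]. *)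
Lemma concatenable_take_drop i j k r (m := index j (vertices i r)) :
  concatenable i j k (take m r) (drop m r)
    = is_dipath i k r && (j \in vertices i r).
Proof.
rewrite /concatenable cat_take_drop /is_dipath.
have E := cat_take_drop m r; have W := is_walk_cat i (take m r) (drop m r).
have L : last i (unzip2 r)
       = last (last i (unzip2 (take m r))) (unzip2 (drop m r)).
  by rewrite -{1}E unzip2_cat last_cat.
rewrite E in W.
have [jr|jr] := boolP (j \in vertices i r).
  have lj : last i (unzip2 (take m r)) = j.
    have := jr; rewrite -index_mem /= ltnS => le_m.
    by rewrite /unzip2 map_take last_take // nth_index.
  rewrite {}W {}L lj eqxx andbT.
  have [U|] := boolP (uniq (vertices i r)); last by rewrite !andbF.
  move: U; rewrite -{1}E /vertices unzip2_cat -cat_cons => U.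
  move: (U); rewrite cat_uniq => /and3P[-> _ _].
  (* [lastI] moves [j] from the end of the first piece to the head of the second, whose simplicity
     can then be read off. *)
  move: U; rewrite lastI lj cat_rcons cat_uniq => /and3P[_ _ ->].
  by rewrite !andbT !andbA.
rewrite andbF; apply/negP=> /and3P[/and3P[_ /eqP lj _] _ _]; case/negP: jr.
by rewrite -E /vertices unzip2_cat -cat_cons mem_cat -{1}lj mem_last.
Qed.

(** * Path sums and the gap between the two sides of the transition inequality *)

Lemma path_matrix_diag (tau : R) j : path_matrix G tau j j = 1.
Proof.
rewrite mxE (bigD1 [bseq of [::]]) /=; last by rewrite /is_dipath /= eqxx.
rewrite expr0 /path_weight big_nil mulr1 big1 ?addr0 // => p /andP[].
case: p => -[|[a v] p] Hp //=.
(* A nonempty path from [j] to [j] would list [j] twice. *)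
by case/and3P=> _ /eqP/= lj /andP[+ _]; rewrite -{1}lj mem_last.
Qed.

Definition path_term (tau : R) p : R := tau ^+ size p * path_weight p.

Local Notation bpath := (n.-bseq (arcs G * 'I_n)).

Lemma sum_concatenable (tau : R) i j k :
  \sum_(pq : bpath * bpath | concatenable i j k pq.1 pq.2)
     path_term tau pq.1 * path_term tau pq.2
  = \sum_(r : bpath | is_dipath i k r && (j \in vertices i r)) path_term tau r.
Proof.
have le_drop m (r : bpath) : (size (drop m r) <= n)%N.
  by rewrite size_drop (leq_trans (leq_subr _ _)) ?size_bseq.
pose h (r : bpath) : bpath * bpath :=
  let m := index j (vertices i r) in ([bseq of take m r], Bseq (le_drop m r)).
(* [insub_bseq] returns the empty sequence when there are more than [n] steps; [le_pq] below
   excludes this for concatenable pairs. *)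
pose h' (pq : bpath * bpath) : bpath := insub_bseq n (pq.1 ++ pq.2).
have hK : cancel h h'.
  move=> r; rewrite /h' /= cat_take_drop.
  by apply: val_inj; rewrite /= insubdK // -topredE /= size_bseq.
rewrite (reindex_onto h h') => [|[p q] /= /and3P[dp dq u]].
  apply: eq_big => [r|r _]; first by rewrite hK eqxx andbT concatenable_take_drop.
  rewrite /path_term mulrACA -exprD -path_weight_cat /=.
  by rewrite -size_cat cat_take_drop.
have le_pq : (size (p ++ q) <= n)%N.
  have := max_card [in vertices i (p ++ q)].
  by rewrite (card_uniqP u) card_ord /= size_map => /ltnW.
have Eh : val (h' (p, q)) = val p ++ val q by rewrite /= insubdK.
case/and3P: dp => _ /eqP lj up.
(* [j] is the last vertex of the simple path [p], so its first occurrence in the concatenation is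
   there. *)
have Em : index j (vertices i (h' (p, q))) = size p.
  rewrite Eh /vertices unzip2_cat -cat_cons index_cat -{1}lj mem_last.
  by rewrite -lj index_last // size_map.
rewrite /h Em; congr pair; apply: val_inj; rewrite /= insubdK //.
  by rewrite take_size_cat.
by rewrite drop_size_cat.
Qed.

(** Exact for every [tau], so it serves both the strict inequality and the equality case. *)
Lemma path_matrix_gap (tau : R) i j k :
  path_matrix G tau i k * path_matrix G tau j j
    - path_matrix G tau i j * path_matrix G tau j k
  = \sum_(r : bpath | avoiding i j k r) path_term tau r
    - \sum_(pq : bpath * bpath | colliding i j k pq.1 pq.2)
        path_term tau pq.1 * path_term tau pq.2.
Proof.
rewrite path_matrix_diag mulr1 !mxE big_distrlr /= pair_big /=.
rewrite (bigID (fun r : bpath => j \in vertices i r)) /= -sum_concatenable.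
rewrite [in X in _ - X](bigID (fun pq : bpath * bpath =>
  uniq (vertices i (pq.1 ++ pq.2)))) /=.
rewrite opprD addrACA -[RHS]add0r; congr (_ + (_ - _)).
  apply/eqP; rewrite subr_eq0; apply/eqP.
  by apply: eq_bigl => pq; rewrite /concatenable andbA.
by apply: eq_bigl => pq; rewrite /colliding andbA.
Qed.

End Dipaths.

(** * Comparing the two sums for small [tau] *)

Section SmallTau.
Context {R : realFieldType}.

Definition for_small (P : R -> Prop) : Prop :=
  exists2 t0 : R, 0 < t0 & forall t, 0 < t -> t < t0 -> P t.

(** Merges the thresholds of the finitely many triples into a single one. *)
Lemma for_small_forall (I : finType) (P : I -> R -> Prop) :
  (forall x, for_small (P x)) -> for_small (fun t => forall x, P x t).
Proof.
move=> smallP.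
suff [t0 t0_gt0 Pt]:
    for_small (fun t => forall x, x \in enum I -> P x t).
  by exists t0 => // t t_gt0 lt_t x; apply: Pt => //; rewrite mem_enum.
elim: (enum I) => [|y s [t1 t1_gt0 Ps]]; first by exists 1.
have [t2 t2_gt0 Py] := smallP y.
exists (Num.min t1 t2) => [|t t_gt0]; first by rewrite lt_min t1_gt0.
by rewrite lt_min => /andP[lt1 lt2] x; rewrite inE => /predU1P[->|/Ps]; auto.
Qed.

Lemma path_matrix_lt_for_small n (G : digraph R n) i j k (r0 : steps G) :
  avoiding i j k r0 ->
  for_small (fun tau : R =>
    path_matrix G tau i j * path_matrix G tau j k
      < path_matrix G tau i k * path_matrix G tau j j).
Proof.
move=> av0; have le_r0 : (size r0 <= n)%N.
  by case/andP: av0 => /dipath_size/ltnW.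
pose b0 : n.-bseq (arcs G * 'I_n) := Bseq le_r0.
have {av0} avb0 : avoiding i j k b0 by [].
have [r avr min_r] := @arg_minnP _ b0 (fun r : n.-bseq _ => avoiding i j k r)
  (fun r : n.-bseq _ => size r) avb0.
pose C := \sum_(pq : n.-bseq (arcs G * 'I_n) * n.-bseq (arcs G * 'I_n)
                | colliding i j k pq.1 pq.2)
            path_weight pq.1 * path_weight pq.2.
have C_ge0 : 0 <= C.
  by apply: sumr_ge0 => pq _; rewrite ltW // mulr_gt0 ?path_weight_gt0.
have C1_gt0 : 0 < C + 1 by rewrite ltr_wpDl.
(* With [tau <= 1], larger exponents give smaller powers; the second bound gives
   [tau * C < path_weight r]. The [+ 1] keeps the denominator positive when [C = 0]. *)
exists (Num.min 1 (path_weight r / (C + 1))) => [|tau tau_gt0].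
  by rewrite lt_min ltr01 divr_gt0 ?path_weight_gt0.
rewrite lt_min => /andP[/ltW tau_le1]; rewrite ltr_pdivlMr // => lt_tau.
rewrite -subr_gt0 path_matrix_gap subr_gt0.
apply: (@le_lt_trans _ _ (tau ^+ (size r).+1 * C)).
  rewrite mulr_sumr; apply: ler_sum => pq col.
  rewrite /path_term mulrACA -exprD ler_wpM2r //.
    by rewrite ltW // mulr_gt0 ?path_weight_gt0.
  (* The shortcut of a colliding pair avoids [j], so it is at least as long as [r], and the pair is
     strictly longer than the shortcut. *)
  rewrite ler_wiXn2l // ?ltW //.
  have [r' avr' lt_r'] := colliding_shortcut col.
  have le_r' : (size r' <= n)%N by case/andP: avr' => /dipath_size/ltnW.
  by apply: leq_ltn_trans lt_r'; apply: (min_r (Bseq le_r')).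
(* The term of [r] alone already beats the collision bound; the other terms are nonnegative. *)
rewrite (bigD1 r) //=; apply: ltr_wpDr.
  by apply: sumr_ge0 => p _; rewrite mulr_ge0 ?exprn_ge0 ?ltW ?path_weight_gt0.
rewrite /path_term exprSr -mulrA ltr_pM2l ?exprn_gt0 //.
by apply: le_lt_trans lt_tau; rewrite ler_wpM2l ?lerDl ?ltW.
Qed.

Lemma path_matrix_bottleneck n (G : digraph R n) (tau : R) i j k :
  (forall p : steps G, is_dipath i k p -> j \in vertices i p) ->
  path_matrix G tau i j * path_matrix G tau j k
    = path_matrix G tau i k * path_matrix G tau j j.
Proof.
move=> through; apply/esym/eqP; rewrite -subr_eq0 path_matrix_gap.
rewrite !big_pred0 ?subrr // => [[p q]|r] /=; apply/negP.
  by case/colliding_shortcut=> r /andP[/through ->].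
by case/andP=> /through ->.
Qed.

Lemma transitional_for_small n (G : digraph R n) i j k :
  for_small (fun tau : R => let S := path_matrix G tau in
    S i j * S j k <= S i k * S j j /\
    (S i j * S j k = S i k * S j j <->
      (forall p : steps G, is_dipath i k p -> j \in vertices i p))).
Proof.
have [/existsP[r avr]|/existsPn none] :=
    boolP [exists r : n.-bseq (arcs G * 'I_n), avoiding i j k r].
  have [t0 t0_gt0 lt_gap] := path_matrix_lt_for_small avr.
  exists t0 => // tau tau_gt0 /(lt_gap _ tau_gt0) lt_S /=; split; first exact: ltW.
  split=> [eq_S|through]; first by rewrite eq_S ltxx in lt_S.
  by case/andP: avr => /through ->.
(* [none] only speaks of sequences of at most [n] steps, but every path is that short. *)
have through (p : steps G) : is_dipath i k p -> j \in vertices i p.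
  move=> dp; have le_p : (size p <= n)%N by rewrite ltnW ?(dipath_size dp).
  by have := none (Bseq le_p); rewrite /avoiding /= dp negbK.
exists 1 => // tau _ _ /=; have eq_S := path_matrix_bottleneck tau through.
by rewrite eq_S lexx.
Qed.

End SmallTau.

Theorem theorem3 (R : realType) (n : nat) (hn : (1 < n)%N) (G : digraph R n) :
  exists tau0 : R, 0 < tau0 /\
    forall tau : R, 0 < tau -> tau < tau0 ->
      transitional_measure G (path_matrix G tau).
Proof.
have [t0 t0_gt0 transS] := for_small_forall (fun ijk : 'I_n * 'I_n * 'I_n =>
  transitional_for_small G ijk.1.1 ijk.1.2 ijk.2).
exists t0; split=> // tau tau_gt0 lt_tau.
by split=> i j k; have [] := transS tau tau_gt0 lt_tau (i, j, k).
Qed.
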